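(* Let $\mathcal{I}(\mathcal{D},\mathcal{P},\mathcal{A})$ be a two-sender unicast index coding problem with an eavesdropper, belonging to Case II-D, i.e. both interactions $\mathcal{D}_2\rightarrow\mathcal{D}_{\{1,2\}}$ and $\mathcal{D}_{\{1,2\}}\rightarrow\mathcal{D}_2$ exist, the interactions $\mathcal{D}_1\rightarrow\mathcal{D}_{\{1,2\}}$ and $\mathcal{D}_{\{1,2\}}\rightarrow\mathcal{D}_1$ do not both exist, and the interactions between $\mathcal{D}_1$ and $\mathcal{D}_2$ are arbitrary. Suppose the interactions $\mathcal{D}_2\rightarrow\mathcal{D}_{\{1,2\}}$ and $\mathcal{D}_{\{1,2\}}\rightarrow\mathcal{D}_2$ are fully-participated. If weakly secure linear index codes exist for the single-sender problems $\mathcal{I}(\mathcal{D}_{\mathcal{T}},\mathcal{A}_{\mathcal{T}})$ for all non-empty $\mathcal{T}\subseteq\{1,2\}$, then the optimal codelength $l^*=l^*(\mathcal{I}(\mathcal{D},\mathcal{P},\mathcal{A}))$ satisfies $$l^*\le\max\{l^*_{\{1,2\}},l^*_2\}+l^*_1 .$$ The bound is attained by the following weakly secure linear two-sender index code, where $\mathcal{C}_{\mathcal{T}}$ is an optimal weakly secure linear code for $\mathcal{I}(\mathcal{D}_{\mathcal{T}},\mathcal{A}_{\mathcal{T}})$: $\mathcal{S}_2$ transmits $\mathcal{C}_2+\mathcal{C}_{\{1,2\}}$ and $\mathcal{S}_1$ transmits $\mathcal{C}_1$.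
   Context: Fix a finite field $\mathbb{F}_q$ and messages $\mathcal{M}=\{x_1,\dots,x_m\}$, $x_i\in\mathbb{F}_q$; $x_i$ is a realization of a random variable $X_i$, and the $X_i$ are independent and uniform on $\mathbb{F}_q$. There are $m$ receivers; receiver $i$ demands $x_i$ and has side-information $\mathcal{K}_i\subseteq\mathcal{M}\setminus\{x_i\}$. The side-information digraph $\mathcal{D}$ has vertices $v_1,\dots,v_m$ and an edge $(v_i,v_j)$ iff $x_j\in\mathcal{K}_i$. For $\mathcal{B}\subseteq[m]=\{1,\dots,m\}$ put $x_{\mathcal{B}}=\{x_i:i\in\mathcal{B}\}$. Single-sender problem $\mathcal{I}(\mathcal{D},\mathcal{A})$: one sender knows all messages and transmits $\mathbf{G}\mathbf{x}$, $\mathbf{G}\in\mathbb{F}_q^{l\times m}$, $\mathbf{x}=(x_1,\dots,x_m)^T$; this is a linear index code of length $l$ if every receiver $i$ can recover $x_i$ from $\mathbf{G}\mathbf{x}$ and $\mathcal{K}_i$. An eavesdropper knows $x_{\mathcal{A}}$ and $\mathbf{G}\mathbf{x}$. The code is weakly secure if $H(X_i\mid\mathbf{G}\mathbf{X},X_{\mathcal{A}})=H(X_i)$ for every message index $i\notin\mathcal{A}$. Two-sender problem $\mathcal{I}(\mathcal{D},\mathcal{P},\mathcal{A})$: sender $\mathcal{S}_j$ knows $\mathcal{M}_j\subseteq\mathcal{M}$, $j\in\{1,2\}$, with $\mathcal{M}_1\cup\mathcal{M}_2=\mathcal{M}$. Put $\mathcal{P}_1=\mathcal{M}_1\setminus\mathcal{M}_2$,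 $\mathcal{P}_2=\mathcal{M}_2\setminus\mathcal{M}_1$, $\mathcal{P}_{\{1,2\}}=\mathcal{M}_1\cap\mathcal{M}_2$, $\mathcal{P}=(\mathcal{P}_1,\mathcal{P}_2,\mathcal{P}_{\{1,2\}})$. Singletons are written without braces: the non-empty $\mathcal{T}\subseteq\{1,2\}$ are $1,2,\{1,2\}$. A linear two-sender index code consists of linear codewords $\mathbf{c}_1,\mathbf{c}_2$ over $\mathbb{F}_q$ of lengths $l_1,l_2$, where $\mathbf{c}_j$ (sent by $\mathcal{S}_j$) is a linear function of the messages in $\mathcal{M}_j$ only, such that each receiver $i$ can recover $x_i$ from $\mathbf{c}_1,\mathbf{c}_2,\mathcal{K}_i$. Its length is $l_1+l_2$. An eavesdropper knows $x_{\mathcal{A}}$, $\mathcal{A}\subsetneq[m]$, and $\mathbf{c}_1,\mathbf{c}_2$; the code is weakly secure if $H(X_i\mid\mathbf{c}_1,\mathbf{c}_2,X_{\mathcal{A}})=H(X_i)$ for all $i\in[m]\setminus\mathcal{A}$. For non-empty $\mathcal{T}\subseteq\{1,2\}$, $\mathcal{D}_{\mathcal{T}}$ is the sub-digraph of $\mathcal{D}$ induced by $\{v_j:x_j\in\mathcal{P}_{\mathcal{T}}\}$ (the problem with messages and receivers restricted to $\mathcal{P}_{\mathcal{T}}$, side-information $\mathcal{K}_i\cap\mathcal{P}_{\mathcal{T}}$), and $\mathcal{A}_{\mathcal{T}}$ is the set of $i\in\mathcal{A}$ with $x_i\in\mathcal{P}_{\mathcal{T}}$. $l^*(\cdot)$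 denotes the minimum length over $\mathbb{F}_q$ of a weakly secure linear index code for the given problem, and $l^*_{\mathcal{T}}=l^*(\mathcal{I}(\mathcal{D}_{\mathcal{T}},\mathcal{A}_{\mathcal{T}}))$. For $\mathcal{T}\ne\mathcal{T}'$, the interaction $\mathcal{D}_{\mathcal{T}}\rightarrow\mathcal{D}_{\mathcal{T}'}$ exists if $\mathcal{D}$ has an edge from some vertex of $\mathcal{D}_{\mathcal{T}}$ to some vertex of $\mathcal{D}_{\mathcal{T}'}$; it is fully-participated if there are edges from every vertex of $\mathcal{D}_{\mathcal{T}}$ to every vertex of $\mathcal{D}_{\mathcal{T}'}$. For two codewords, $\mathbf{c}+\mathbf{c}'$ denotes symbol-wise addition after appending zeros at the end of the shorter one to match the length of the longer one. *)

(* Defs.v *)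
From HB Require Import structures.
From mathcomp Require Import all_boot all_order all_algebra.
From mathcomp Require Import all_classical all_reals all_analysis.

Set Implicit Arguments.
Unset Strict Implicit.
Unset Printing Implicit Defensive.

Import Order.TTheory GRing.Theory Num.Theory.
Local Open Scope ring_scope.

(* Messages are indexed by 'I_n; a realization of all of them is a column
   vector x : 'cV[F]_n.  Random variables are functions of this vector. *)
Section Entropy.
Variables (R : realType) (F : finFieldType) (n : nat).

(* Joint law of independent X_1, ..., X_n, each uniform on F. *)
Definition message_law (x : 'cV[F]_n) : R := \prod_(i < n) (#|F|%:R)^-1.

Definition prob (E : pred 'cV[F]_n) : R := \sum_(x | E x) message_law x.

(* Entropies are in nats; equalities between entropies do not depend on the
   base.  The convention 0 log 0 = 0 is automatic, and a zero denominator in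
   [cond_entropy] only occurs in terms of weight 0. *)
Definition entropy (T : finType) (Z : 'cV[F]_n -> T) : R :=
  - \sum_(z : T) prob [pred x | Z x == z] * ln (prob [pred x | Z x == z]).

Definition cond_entropy (T U : finType)
    (Z : 'cV[F]_n -> T) (Y : 'cV[F]_n -> U) : R :=
  - \sum_(z : T) \sum_(y : U)
      prob [pred x | (Z x == z) && (Y x == y)] *
      ln (prob [pred x | (Z x == z) && (Y x == y)] / prob [pred x | Y x == y]).

End Entropy.

Section Codes.
Variables (F : finFieldType) (n : nat).

(* x_S, its entries listed in the order of [enum S]. *)
Definition subvec (S : {set 'I_n}) (x : 'cV[F]_n) : 'cV[F]_#|S| :=
  \col_j x (enum_val j) 0.

(* A side-information digraph is a relation D : rel 'I_n, with D i j meaning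
   that receiver i has message j. *)
Definition side_info (D : rel 'I_n) (i : 'I_n) : {set 'I_n} := [set j | D i j].

Definition recovers (D : rel 'I_n) (T : Type) (enc : 'cV[F]_n -> T)
    (i : 'I_n) : Prop :=
  exists dec : T -> 'cV[F]_#|side_info D i| -> F,
    forall x : 'cV[F]_n, dec (enc x) (subvec (side_info D i) x) = x i 0.

Definition weakly_secure (R : realType) (A : {set 'I_n}) (T : finType)
    (enc : 'cV[F]_n -> T) : Prop :=
  forall i : 'I_n, i \notin A ->
    cond_entropy R (fun x : 'cV[F]_n => x i 0) (fun x => (enc x, subvec A x)) =
    entropy R (fun x : 'cV[F]_n => x i 0).

Definition secure_code (R : realType) (D : rel 'I_n) (A : {set 'I_n})
    (l : nat) (G : 'M[F]_(l, n)) : Prop :=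
  (forall i, recovers D (fun x => G *m x) i) /\
  weakly_secure R A (fun x => G *m x).

Definition linear_function_of (S : {set 'I_n}) (l : nat)
    (c : 'cV[F]_n -> 'cV[F]_l) : Prop :=
  exists G : 'M[F]_(l, #|S|), forall x, c x = G *m subvec S x.

Definition secure_two_sender_code (R : realType) (D : rel 'I_n)
    (M1 M2 A : {set 'I_n}) (l1 l2 : nat)
    (c1 : 'cV[F]_n -> 'cV[F]_l1) (c2 : 'cV[F]_n -> 'cV[F]_l2) : Prop :=
  [/\ linear_function_of M1 c1,
      linear_function_of M2 c2,
      (forall i, recovers D (fun x => (c1 x, c2 x)) i) &
      weakly_secure R A (fun x => (c1 x, c2 x))].

End Codes.

(* The minimum of a nonempty set of naturals; 0 on the empty set. *)
Definition minimum (Q : nat -> Prop) : nat :=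
  xget 0%N [set l | Q l /\ forall k, Q k -> (l <= k)%N]%classic.

Definition lstar (R : realType) (F : finFieldType) (n : nat)
    (D : rel 'I_n) (A : {set 'I_n}) : nat :=
  minimum (fun l => exists G : 'M[F]_(l, n), secure_code R D A G).

Definition lstar_two_sender (R : realType) (F : finFieldType) (n : nat)
    (D : rel 'I_n) (M1 M2 A : {set 'I_n}) : nat :=
  minimum (fun l => exists (l1 l2 : nat)
    (c1 : 'cV[F]_n -> 'cV[F]_l1) (c2 : 'cV[F]_n -> 'cV[F]_l2),
    secure_two_sender_code R D M1 M2 A c1 c2 /\ l = (l1 + l2)%N).

(* The nonempty subsets {1}, {2} and {1,2} of {1,2}. *)
Inductive senders := S1 | S2 | S12.

Definition part (m : nat) (M1 M2 : {set 'I_m}) (T : senders) : {set 'I_m} :=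
  match T with
  | S1 => M1 :\: M2
  | S2 => M2 :\: M1
  | S12 => M1 :&: M2
  end.

(* [induced_digraph] and [index_subset] give the problem restricted to the messages
   in P, relabelled by 'I_#|P| consistently with [subvec P]. *)
Definition induced_digraph (m : nat) (D : rel 'I_m) (P : {set 'I_m}) :
    rel 'I_#|P| :=
  fun i j => D (enum_val i) (enum_val j).
Arguments induced_digraph {m} D P _ _.

Definition index_subset (m : nat) (A P : {set 'I_m}) : {set 'I_#|P|} :=
  [set i | enum_val i \in A].

Definition interaction (m : nat) (D : rel 'I_m) (P Q : {set 'I_m}) : Prop :=
  exists i j, [/\ i \in P, j \in Q & D i j].

Definition fully_participated (m : nat) (D : rel 'I_m)
    (P Q : {set 'I_m}) : Prop :=
  forall i j, i \in P -> j \in Q -> D i j.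

Definition pad (F : finFieldType) (k n : nat) (u : 'cV[F]_k) : 'cV[F]_n :=
  \col_(i < n) oapp (fun j : 'I_k => u j 0) 0 (insub (i : nat)).

Definition padadd (F : finFieldType) (k l : nat)
    (u : 'cV[F]_k) (v : 'cV[F]_l) : 'cV[F]_(maxn k l) :=
  pad (maxn k l) u + pad (maxn k l) v.

(* Main.v *)
(* A linear observation G x reveals x_i exactly when x_i is constant on the
   fibres of G, and otherwise G has a kernel vector u with u_i <> 0; translating
   by multiples of u makes the conditional law of X_i uniform.  So weak security
   of a code means that each i outside A has a kernel vector u with u_i <> 0 and
   u_A = 0.  Such a vector for the subcode on one part, extended by zero to all
   messages, is still killed by the two-sender code.  For decoding, a receiver in
   P_2 knows all of P_{1,2} by full participation, so it can cancel C_{1,2} from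
   the sum sent by the second sender, and symmetrically. *)
Require Import Defs.
From HB Require Import structures.
From mathcomp Require Import all_boot all_order all_algebra.
From mathcomp Require Import all_classical all_reals all_analysis.
Local Open Scope ring_scope.
Set Implicit Arguments.
Unset Strict Implicit.
Unset Printing Implicit Defensive.
Import Order.TTheory GRing.Theory Num.Theory.

(** * Entropy of a single message under the uniform law *)

Section UniformMessages.
Variables (R : realType) (F : finFieldType) (n : nat).
Local Notation prob := (@prob R F n).

Lemma message_law_gt0 (x : 'cV[F]_n) : 0 < message_law R x.
Proof.
apply: prodr_gt0 => i _; rewrite invr_gt0 ltr0n.
by apply/card_gt0P; exists 0.
Qed.

Lemma eq_prob (E E' : pred 'cV[F]_n) : E =1 E' -> prob E = prob E'.
Proof. by move=> eqE; apply: eq_bigl. Qed.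

Lemma prob_shift (E : pred 'cV[F]_n) (v : 'cV[F]_n) :
  prob [pred x | E (x + v)] = prob E.
Proof.
rewrite /Defs.prob [RHS](reindex (fun x => x + v)) //=.
by exists (fun x => x - v) => x _; rewrite ?addrK ?subrK.
Qed.

Lemma prob_partition (T : finType) (Z : 'cV[F]_n -> T) (E : pred 'cV[F]_n) :
  \sum_z prob [pred x | (Z x == z) && E x] = prob E.
Proof.
rewrite /Defs.prob (partition_big Z predT) //=; apply: eq_bigr => z _.
by apply: eq_bigl => x /=; rewrite andbC.
Qed.

Lemma prob_total : prob predT = 1.
Proof.
rewrite /Defs.prob /message_law prodr_const card_ord sumr_const.
have -> : #|(predT : pred 'cV[F]_n)| = #|{: 'cV[F]_n}| by [].
rewrite card_mx muln1 -[_ *+ _]mulr_natr natrX -exprMn mulVf ?expr1n //.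
by rewrite pnatr_eq0 -lt0n; apply/card_gt0P; exists 0.
Qed.

Lemma prob_gt0 (E : pred 'cV[F]_n) (x : 'cV[F]_n) : E x -> 0 < prob E.
Proof.
move=> Ex; rewrite /Defs.prob (bigD1 x) //= ltr_wpDr ?message_law_gt0 //.
by apply: sumr_ge0 => y _; exact/ltW/message_law_gt0.
Qed.

Lemma prob0 (E : pred 'cV[F]_n) : (forall x, ~~ E x) -> prob E = 0.
Proof. by move=> E0; apply: big_pred0 => x; exact/negbTE. Qed.

Lemma card_field_gt1 : 1 < #|F|%:R :> R.
Proof. by rewrite ltr1n card_finNzRing_gt1. Qed.

Lemma sum_const_field (a : R) : \sum_(z : F) a = a * #|F|%:R.
Proof. by rewrite sumr_const mulr_natr. Qed.

(** Translation by multiples of [u] preserves both the law and [Y], and moves coordinate [i] through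
    all of [F]. The events for the different values [z] are therefore equiprobable, and they
    partition the event [Y x == y]. *)
Lemma prob_coord_shift (U : finType) (Y : 'cV[F]_n -> U) (u : 'cV[F]_n) i z y :
  (forall a x, Y (x + a *: u) = Y x) -> u i 0 != 0 ->
  prob [pred x : 'cV[F]_n | (x i 0 == z) && (Y x == y)] =
  prob [pred x | Y x == y] / #|F|%:R.
Proof.
move=> Yu ui.
have q0 : #|F|%:R != 0 :> R.
  by rewrite gt_eqF // (lt_trans ltr01) // card_field_gt1.
rewrite -[in RHS](prob_partition (fun x : 'cV[F]_n => x i 0)).
rewrite (eq_bigr (fun=> prob [pred x : 'cV[F]_n | (x i 0 == z) && (Y x == y)])).
  by rewrite sum_const_field mulfK.
(* This multiple of [u] adds exactly [z - z'] to coordinate [i], so it carries the value [z'] to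
   [z]. *)
move=> z' _; rewrite -[RHS](prob_shift _ (((z - z') / u i 0) *: u)).
apply: eq_prob => x /=; rewrite Yu !mxE divfK //.
by rewrite addrA subr_eq addrC (inj_eq (addrI z)).
Qed.

(** Every conditional probability of a value of coordinate [i] is the inverse of [#|F|], so the
    logarithm is constant and the weights sum to 1. *)
Lemma cond_entropy_uniform (U : finType) (Y : 'cV[F]_n -> U) (u : 'cV[F]_n) i :
  (forall a x, Y (x + a *: u) = Y x) -> u i 0 != 0 ->
  cond_entropy R (fun x : 'cV[F]_n => x i 0) Y = ln #|F|%:R.
Proof.
move=> Yu ui; rewrite /cond_entropy exchange_big /=.
have q1 := card_field_gt1.
have q_gt0 : 0 < #|F|%:R :> R by apply: lt_trans q1.
have q0 : #|F|%:R != 0 :> R by rewrite gt_eqF.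
rewrite (eq_bigr (fun y => prob [pred x | Y x == y] * - ln #|F|%:R)).
  rewrite -mulr_suml mulrN opprK.
  rewrite (eq_bigr (fun y => prob [pred x | (Y x == y) && predT x])).
    by rewrite prob_partition prob_total mul1r.
  by move=> y _; apply: eq_prob => x /=; rewrite andbT.
move=> y _.
rewrite (eq_bigr (fun=> prob [pred x | Y x == y] / #|F|%:R * - ln #|F|%:R)).
  by rewrite sum_const_field mulrAC mulfVK.
move=> z _; rewrite (prob_coord_shift _ _ Yu ui).
(* An impossible observation has weight 0 on both sides; otherwise its probability cancels inside
   the logarithm. *)
have [->|p0] := eqVneq (prob [pred x | Y x == y]) 0; first by rewrite !mul0r.
by rewrite [_ / _ / _]mulrAC divff // mul1r lnV // posrE.
Qed.

(** Unconditional entropy is treated as conditioning on a constant observation. Every translation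
    preserves that observation, so any vector with a nonzero entry at [i] will do. *)
Lemma entropy_coord (i : 'I_n) :
  entropy R (fun x : 'cV[F]_n => x i 0) = ln #|F|%:R.
Proof.
pose u : 'cV[F]_n := const_mx 1.
have ui : u i 0 != 0 by rewrite mxE oner_neq0.
rewrite -(@cond_entropy_uniform unit (fun=> tt) u i) //.
congr (- _); apply: eq_bigr => z _; rewrite (big_pred1 tt); last by case.
have -> : prob [pred x | tt == tt] = 1 by rewrite -prob_total; apply: eq_prob.
rewrite divr1.
have -> // : prob [pred x : 'cV[F]_n | (x i 0 == z) && (tt == tt)] =
  prob [pred x : 'cV[F]_n | x i 0 == z].
by apply: eq_prob => x /=; rewrite andbT.
Qed.

(** Each term vanishes: either no message vector realizes the pair and the weight is 0, or [Z] is
    constant on the fibre of [Y], and the conditional probability is 1. *)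
Lemma cond_entropy_determined (T U : finType) (Z : 'cV[F]_n -> T)
    (Y : 'cV[F]_n -> U) :
  (forall x x', Y x = Y x' -> Z x = Z x') -> cond_entropy R Z Y = 0.
Proof.
move=> ZY; rewrite /cond_entropy big1 ?oppr0 // => z _; rewrite big1 // => y _.
have [/existsP[x0 /= /andP[/eqP Zx0 /eqP Yx0]] | /existsPn none] :=
  boolP [exists x, (Z x == z) && (Y x == y)]; last by rewrite prob0 ?mul0r.
have -> : prob [pred x | (Z x == z) && (Y x == y)] = prob [pred x | Y x == y].
  apply: eq_prob => x /=; case: (Y x =P y) => [Yx|]; rewrite ?andbF // andbT.
  by rewrite -Zx0; apply/eqP/ZY; rewrite Yx.
by rewrite divff ?ln1 ?mulr0 // gt_eqF // (prob_gt0 (x := x0)) //= Yx0.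
Qed.

End UniformMessages.

(** * Restriction, extension by zero, and kernel criteria for decoding and security *)

Section Subvectors.
Variables (F : finFieldType) (n : nat).
Implicit Types (S P : {set 'I_n}) (x : 'cV[F]_n).

(* Multiplication by [embed_mx S] extends a vector on S by zero. *)
Definition embed_mx S : 'M[F]_(n, #|S|) := \matrix_(i, j) (i == enum_val j)%:R.

Lemma subvecE S x : subvec S x = (embed_mx S)^T *m x.
Proof.
apply/colP => j; rewrite !mxE (bigD1 (enum_val j)) //= !mxE eqxx mul1r.
by rewrite big1 ?addr0 // => i /negbTE ij; rewrite !mxE ij mul0r.
Qed.

Lemma subvecD S x y : subvec S (x + y) = subvec S x + subvec S y.
Proof. by rewrite !subvecE mulmxDr. Qed.

Lemma subvecZ S a x : subvec S (a *: x) = a *: subvec S x.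
Proof. by rewrite !subvecE scalemxAr. Qed.

Lemma embed_enum_val S (u : 'cV[F]_#|S|) j :
  (embed_mx S *m u) (enum_val j) 0 = u j 0.
Proof.
rewrite mxE (bigD1 j) //= mxE eqxx mul1r big1 ?addr0 // => k kj.
by rewrite mxE (inj_eq enum_val_inj) eq_sym (negbTE kj) mul0r.
Qed.

Lemma embed_notin S (u : 'cV[F]_#|S|) i :
  i \notin S -> (embed_mx S *m u) i 0 = 0.
Proof.
move=> iS; rewrite mxE big1 // => j _; rewrite mxE.
have [eq_i|_] := eqVneq i (enum_val j); last by rewrite mul0r.
by rewrite eq_i enum_valP in iS.
Qed.

Lemma embedK S : cancel (mulmx (embed_mx S)) (@subvec F n S).
Proof. by move=> u; apply/colP => j; rewrite mxE embed_enum_val. Qed.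

Lemma subvec_embed_sub S P x :
  P \subset S -> subvec P (embed_mx S *m subvec S x) = subvec P x.
Proof.
move=> /fintype.subsetP sPS; apply/colP => j; rewrite [LHS]mxE [RHS]mxE.
have jS := sPS _ (enum_valP j).
by rewrite -(enum_rankK_in jS jS) embed_enum_val mxE.
Qed.

Lemma subvec_embed_disjoint S P (u : 'cV[F]_#|S|) :
  [disjoint P & S] -> subvec P (embed_mx S *m u) = 0.
Proof.
move=> dPS; apply/colP => j; rewrite [LHS]mxE [RHS]mxE embed_notin //.
by rewrite (disjointFr dPS (enum_valP j)).
Qed.

Lemma eq_subvec S x x' :
  subvec S x = subvec S x' <-> {in S, forall i, x i 0 = x' i 0}.
Proof.
split=> [eq_xx' i iS | eq_xx'].
  by move/colP: eq_xx' => /(_ (enum_rank_in iS i)); rewrite !mxE enum_rankK_in.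
by apply/colP => j; rewrite !mxE eq_xx' ?enum_valP.
Qed.

(** If erasing the entries outside [S] does not change [c], then the columns of [H] indexed by [S]
    already compute it. *)
Lemma linear_function_of_factor S l (H : 'M[F]_(l, n)) (c : 'cV[F]_n -> 'cV_l) :
  (forall x, c x = H *m x) ->
  (forall x, c (embed_mx S *m subvec S x) = c x) -> linear_function_of S c.
Proof. by move=> cH cS; exists (H *m embed_mx S) => x; rewrite -cS cH mulmxA. Qed.

(** This removes decoders from later arguments: decoding is possible exactly when two message
    vectors that look alike to receiver [i] agree at [i]. *)
Lemma recoversP (D : rel 'I_n) (T : Type) (enc : 'cV[F]_n -> T) i :
  recovers D enc i <->
  forall x x', enc x = enc x' -> (forall j, D i j -> x j 0 = x' j 0) ->
    x i 0 = x' i 0.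
Proof.
split=> [[dec decE] x x' eq_enc eq_side | det].
  rewrite -(decE x) -(decE x') eq_enc; congr (dec _ _).
  by apply/eq_subvec => j; rewrite inE => /eq_side.
(* The decoder picks any message vector consistent with its input. The default of [xget] matters
   only on inputs that never occur. *)
pose fibre t s : set 'cV[F]_n :=
  [set x | enc x = t /\ subvec (side_info D i) x = s]%classic.
exists (fun t s => (xget 0 (fibre t s)) i 0) => x.
have [] : fibre (enc x) (subvec (side_info D i) x)
              (xget 0 (fibre (enc x) (subvec (side_info D i) x))).
  exact: (@xgetPex _ 0 (fibre _ _)) (ex_intro _ x (conj erefl erefl)).
by move=> /det eq_i /eq_subvec eq_side; apply: eq_i => j Dij; rewrite eq_side ?inE.
Qed.

Lemma weakly_secure_of_kernel (R : realType) (A : {set 'I_n}) (T : finType)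
    (enc : 'cV[F]_n -> T) :
  (forall i, i \notin A -> exists u : 'cV[F]_n,
    [/\ forall a x, enc (x + a *: u) = enc x, subvec A u = 0 & u i 0 != 0]) ->
  weakly_secure R A enc.
Proof.
move=> wit i /wit[u [encu Au ui]]; rewrite entropy_coord.
apply: (@cond_entropy_uniform _ _ _ _ _ u) => // a x.
by rewrite encu subvecD subvecZ Au scaler0 addr0.
Qed.

(** Without such a [u], the difference of two message vectors with the same observation would vanish
    at [i]. The observation would then determine [x i 0], giving conditional entropy 0, whereas the
    entropy of the message is [ln #|F|%:R], which is positive. *)
Lemma weakly_secure_kernel (R : realType) (A : {set 'I_n}) l
    (G : 'M[F]_(l, n)) i :
  weakly_secure R A (fun x => G *m x) -> i \notin A ->
  exists u : 'cV[F]_n, [/\ G *m u = 0, subvec A u = 0 & u i 0 != 0].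
Proof.
move=> secG iA; apply: contrapT => no_u; have /eqP := secG i iA; apply/negP.
rewrite entropy_coord cond_entropy_determined.
  by rewrite lt_eqF // ln_gt0 // card_field_gt1.
move=> x x' [eqG eqA]; apply/eqP; rewrite -subr_eq0; apply/negPn/negP => xx'.
apply: no_u; exists (x - x'); split; last by rewrite !mxE.
- by rewrite mulmxBr eqG subrr.
- by rewrite !subvecE mulmxBr -!subvecE eqA subrr.
Qed.

End Subvectors.

(** * Zero-padding as an injective linear map *)

Section Padding.
Variable F : finFieldType.

Lemma pad_mulmx (k l : nat) (u : 'cV[F]_k) :
  pad l u = (\matrix_(i < l, j < k) (i == j :> nat)%:R) *m u.
Proof.
apply/colP => i; rewrite !mxE; case: insubP => [j _ ji | ik] /=.
  rewrite (bigD1 j) //= !mxE ji eqxx mul1r big1 ?addr0 // => j' j'j.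
  by rewrite !mxE -ji eq_sym (inj_eq val_inj) (negbTE j'j) mul0r.
rewrite big1 // => j _; rewrite !mxE.
have [ij|_] := eqVneq (i : nat) j; last by rewrite mul0r.
by rewrite ij ltn_ord in ik.
Qed.

Lemma pad_inj (k l : nat) : (k <= l)%N -> injective (@pad F k l).
Proof.
move=> kl u v /colP eq_uv; apply/colP => j.
by have := eq_uv (widen_ord kl j); rewrite !mxE /= valK.
Qed.

End Padding.

(** One element of [Q] suffices to exclude the default value 0 of [minimum]. *)
Lemma minimumP (Q : nat -> Prop) (l : nat) :
  Q l -> Q (minimum Q) /\ forall k, Q k -> (minimum Q <= k)%N.
Proof.
move=> Ql; have exQ : exists k, `[< Q k >] by exists l; apply/asboolP.
have [k /asboolP Qk kmin] := ex_minnP exQ.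
apply: (@xgetPex _ 0%N [set l | Q l /\ forall k, Q k -> (l <= k)%N]%classic).
by exists k; split=> // k' /asboolP/kmin.
Qed.

(** * From the subcodes on the parts to the two-sender code *)

Section Parts.
Variables (R : realType) (F : finFieldType) (m : nat).
Variables (D : rel 'I_m) (A : {set 'I_m}).

Lemma subcode_decodes (P : {set 'I_m}) l (G : 'M[F]_(l, #|P|)) i
    (x x' : 'cV[F]_m) :
  secure_code R (induced_digraph D P) (index_subset A P) G -> i \in P ->
  G *m subvec P x = G *m subvec P x' ->
  (forall j, D i j -> x j 0 = x' j 0) -> x i 0 = x' i 0.
Proof.
move=> [recG _] iP eqG eq_side.
have /recoversP/(_ (subvec P x) (subvec P x') eqG) :=
  recG (enum_rank_in iP i).
rewrite !mxE enum_rankK_in //; apply=> j.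
by rewrite /induced_digraph enum_rankK_in // !mxE => /eq_side.
Qed.

(** The kernel vector given by security of the subcode is extended by zero. On [A] it vanishes
    inside [P] by security of the subcode, and outside [P] by the extension. *)
Lemma subcode_kernel (P : {set 'I_m}) l (G : 'M[F]_(l, #|P|)) i :
  secure_code R (induced_digraph D P) (index_subset A P) G ->
  i \in P -> i \notin A ->
  exists u : 'cV[F]_#|P|, [/\ G *m u = 0,
    subvec A (embed_mx F P *m u) = 0 & (embed_mx F P *m u) i 0 != 0].
Proof.
move=> [_ secG] iP iA.
have [|u [Gu Au ui]] := weakly_secure_kernel (i := enum_rank_in iP i) secG.
  by rewrite inE enum_rankK_in.
exists u; split=> //; last first.
  by rewrite -{1}(enum_rankK_in iP iP) embed_enum_val.
apply/colP => j; rewrite [LHS]mxE [RHS]mxE.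
have [jP | jP] := boolP (enum_val j \in P); last exact: embed_notin.
rewrite -(enum_rankK_in jP jP) embed_enum_val.
have -> : 0 = (0 : 'cV[F]_#|P|) (enum_rank_in jP (enum_val j)) 0 by rewrite mxE.
have /eq_subvec : subvec (index_subset A P) u = subvec (index_subset A P) 0.
  by rewrite Au subvecE mulmx0.
by apply; rewrite inE enum_rankK_in // enum_valP.
Qed.

(** Stated for secure subcodes of any lengths, so that it serves both the bound on the minimum and
    the claim about every choice of optimal subcodes. *)
Lemma sum_code_secure (M1 M2 : {set 'I_m}) (l : senders -> nat)
    (C : forall T, 'M[F]_(l T, #|part M1 M2 T|)) :
  M1 :|: M2 = [set: 'I_m] ->
  fully_participated D (part M1 M2 S2) (part M1 M2 S12) ->
  fully_participated D (part M1 M2 S12) (part M1 M2 S2) ->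
  (forall T, secure_code R (induced_digraph D (part M1 M2 T))
               (index_subset A (part M1 M2 T)) (C T)) ->
  secure_two_sender_code R D M1 M2 A
    (fun x => C S1 *m subvec (part M1 M2 S1) x)
    (fun x => padadd (C S2 *m subvec (part M1 M2 S2) x)
                     (C S12 *m subvec (part M1 M2 S12) x)).
Proof.
move=> cover full_2_12 full_12_2 secC.
have partP i : exists T, i \in part M1 M2 T.
  have : i \in M1 :|: M2 by rewrite cover inE.
  rewrite inE.
  case iM1: (i \in M1); case iM2: (i \in M2) => //= _;
  by [exists S12; rewrite inE iM1 iM2 | exists S1; rewrite inE iM1 iM2
     | exists S2; rewrite inE iM1 iM2].
have disj T T' : T <> T' -> [disjoint part M1 M2 T & part M1 M2 T'].
  move=> TT'; rewrite disjoint_subset; apply/fintype.subsetP => i.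
  by case: T T' TT' => [] [] //= _; rewrite !inE; case: (i \in M1); case: (i \in M2).
set c1 := fun x => C S1 *m _; set c2 := fun x => padadd _ _.
(* Padding is multiplication by a matrix, so the padded sum is linear in [x]; the matrix [H] is
   found by unification. *)
have [H c2H] : exists H, forall x, c2 x = H *m x.
  eexists => x; rewrite /c2 /padadd !pad_mulmx !subvecE !mulmxA.
  by rewrite -mulmxDl.
split.
- apply: (linear_function_of_factor (H := C S1 *m (embed_mx F (part M1 M2 S1))^T)).
    by move=> x; rewrite /c1 subvecE mulmxA.
  by move=> x; rewrite /c1 subvec_embed_sub // subsetDl.
- apply: (linear_function_of_factor c2H) => x.
  by rewrite /c2 !subvec_embed_sub // ?subsetDl ?subsetIr.
- move=> i; apply/recoversP => x x' [eq1 eq2] eq_side.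
  have [[] iP] := partP i.
  + exact: (subcode_decodes (secC S1) iP).
  + apply: (subcode_decodes (secC S2) iP) => //.
    (* Padding to the longer length loses nothing, so it is enough to compare the padded codewords
       once the common [C S12] summand is cancelled. *)
    apply: (pad_inj (leq_maxl (l S2) (l S12))); move: eq2; rewrite /c2 /padadd.
    have -> : subvec (part M1 M2 S12) x = subvec (part M1 M2 S12) x'.
      by apply/eq_subvec => j jP; apply: eq_side; exact: full_2_12.
    by move/addIr.
  + apply: (subcode_decodes (secC S12) iP) => //.
    apply: (pad_inj (leq_maxr (l S2) (l S12))); move: eq2; rewrite /c2 /padadd.
    have -> : subvec (part M1 M2 S2) x = subvec (part M1 M2 S2) x'.
      by apply/eq_subvec => j jP; apply: eq_side; exact: full_12_2.
    by move/addrI.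
- apply: weakly_secure_of_kernel => i iA; have [T iP] := partP i.
  have [u [Cu Au ui]] := subcode_kernel (secC T) iP iA.
  exists (embed_mx F (part M1 M2 T) *m u); split=> // a x.
  (* The subcode on [T] kills [u] by choice; the other subcodes read only zeros, because the parts
     are disjoint. *)
  have Cu0 T' : C T' *m subvec (part M1 M2 T') (embed_mx F (part M1 M2 T) *m u) = 0.
    have [TT' | TT'] := pselect (T' = T); first by rewrite TT' embedK.
    by rewrite subvec_embed_disjoint ?mulmx0 //; exact: disj.
  by rewrite /c1 /c2 !subvecD !subvecZ !mulmxDr -!scalemxAr !Cu0 !scaler0 !addr0.
Qed.

End Parts.

(** * Optimal lengths and the resulting bound *)

Theorem corollary3 (R : realType) (F : finFieldType) (m : nat)
  (D : rel 'I_m) (M1 M2 A : {set 'I_m})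
  (D_irr : irreflexive D)
  (M_cover : M1 :|: M2 = [set: 'I_m])
  (A_proper : A \proper [set: 'I_m])
  (inter_2_12 : interaction D (part M1 M2 S2) (part M1 M2 S12))
  (inter_12_2 : interaction D (part M1 M2 S12) (part M1 M2 S2))
  (not_both_1_12 : ~ (interaction D (part M1 M2 S1) (part M1 M2 S12) /\
                      interaction D (part M1 M2 S12) (part M1 M2 S1)))
  (full_2_12 : fully_participated D (part M1 M2 S2) (part M1 M2 S12))
  (full_12_2 : fully_participated D (part M1 M2 S12) (part M1 M2 S2))
  (codes_exist : forall T : senders,
    exists (l : nat) (G : 'M[F]_(l, #|part M1 M2 T|)),
      secure_code R (induced_digraph D (part M1 M2 T))
        (index_subset A (part M1 M2 T)) G) :
  let lT (T : senders) :=
    lstar R F (induced_digraph D (part M1 M2 T)) (index_subset A (part M1 M2 T)) in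
  [/\ (* a weakly secure linear two-sender code exists, so l* is a minimum *)
      (exists (l1 l2 : nat)
         (c1 : 'cV[F]_m -> 'cV[F]_l1) (c2 : 'cV[F]_m -> 'cV[F]_l2),
         secure_two_sender_code R D M1 M2 A c1 c2),
      (lstar_two_sender R F D M1 M2 A <= maxn (lT S12) (lT S2) + lT S1)%N &
      (* attained by S_1 sending C_1 and S_2 sending C_2 + C_{1,2} *)
      forall (l : senders -> nat)
        (C : forall T : senders, 'M[F]_(l T, #|part M1 M2 T|)),
        (forall T : senders,
           secure_code R (induced_digraph D (part M1 M2 T))
             (index_subset A (part M1 M2 T)) (C T) /\ l T = lT T) ->
        secure_two_sender_code R D M1 M2 A
          (fun x => C S1 *m subvec (part M1 M2 S1) x)
          (fun x => padadd (C S2 *m subvec (part M1 M2 S2) x)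
                           (C S12 *m subvec (part M1 M2 S12) x)) /\
        (l S1 + maxn (l S2) (l S12) = maxn (lT S12) (lT S2) + lT S1)%N].
Proof.
move=> lT.
have secure_sum := sum_code_secure (R := R) (F := F) (A := A) M_cover full_2_12 full_12_2.
have length_sum (l : senders -> nat) : (forall T, l T = lT T) ->
    (l S1 + maxn (l S2) (l S12) = maxn (lT S12) (lT S2) + lT S1)%N.
  by move=> lE; rewrite !lE maxnC addnC.
pose achieved T l := exists G : 'M[F]_(l, #|part M1 M2 T|),
  secure_code R (induced_digraph D (part M1 M2 T))
    (index_subset A (part M1 M2 T)) G.
(* Existence of some secure subcode makes [lT T] a genuine minimum, attained by a code that can then
   be chosen as [C T]. *)
have optimal T : achieved T (lT T).
  by have [l exG] := codes_exist T; have [] := @minimumP (achieved T) l exG.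
pose C T := projT1 (cid (optimal T)).
have secC := secure_sum lT C (fun T => projT2 (cid (optimal T))).
split.
- by do 4 eexists; exact: secC.
- rewrite -(length_sum lT) // /lstar_two_sender.
  set Q := (Q in minimum Q).
  (* The sum code built from the chosen optimal subcodes witnesses this length, so the two-sender
     minimum cannot exceed it. *)
  have Ql : Q (lT S1 + maxn (lT S2) (lT S12))%N.
    by do 4 eexists; split; first exact: secC.
  by have [_ ->] := minimumP Ql.
- move=> l C' optC'; split; last by apply: length_sum => T; have [] := optC' T.
  by apply: secure_sum => T; have [] := optC' T.
Qed.
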